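(* Let $q,r,\mu,\nu$ be positive integers with $\nu\ge q+r$. Let $\bar{\mathcal{K}}_*^{\mu-1}(z)$ be the matrix $\bar{\mathcal{K}}^{\mu-1}(z)$ defined below for the parameter value $\nu_*=q+r-1$ in place of $\nu$, and put \[ \bar{\bar{\mathcal{K}}}^{\mu-1}(z)=\begin{pmatrix}\bar{\mathcal{K}}_*^{\mu-1}(z)&0\\0&I_{r(\nu-q-r+1)}\end{pmatrix}. \] Then the kernel of $\mathcal{N}(z)$ is spanned by the columns of $\bar{\bar{\mathcal{K}}}^{\mu-1}(z)$ and has dimension $\nu r-\mu q$ if $\mu<r$ and $(\nu-q)r$ if $\mu\ge r$; that is, $\dim\ker\mathcal{N}(z)=\nu r-q\min\{\mu,r\}$.
   Context: Matrix indices start at $0$; $'$ and $^{(j)}$ denote $z$-derivatives. $u(z)=(1,\dots,z^{q-1})^\top$, $w(z)=(1,\dots,z^{r-1})$, $M(z)=u(z)w(z)$; $\mathcal{N}(z)\in\mathbb{C}^{\mu q\times\nu r}$ is the block matrix with $(i,j)$ block $\frac{1}{i!j!}M^{(i+j)}(z)$. Construction of $\bar{\mathcal{K}}^{\mu-1}$ for a parameter $\nu'$ with $q+1\le\nu'\le q+r-1$ (here $\nu'=\nu_*=q+r-1$, requiring $r\ge2$): $S_n$ is the $n\times n$ shift matrix $(S_n)_{ij}=\delta_{i+1,j}$; $\ell_q$ is the last standard basis vector of $\mathbb{R}^q$, $\varphi$ the first standard basis vector of $\mathbb{R}^{\nu'-q}$; $G(z)\in\mathbb{C}^{r\times r}$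 has entries $G_{ij}=z^{j-i-1}$ for $j>i$, $0$ otherwise; $G_{j0}(z)$ is the matrix of the first $r-j$ rows of $G(z)$; $F_j(z)\in\mathbb{C}^{(r-j)\times(r-j-1)}$ ($0\le j\le r-2$) has $(F_j)_{ii}=-z$, $(F_j)_{i+1,i}=1$, zero otherwise. For $0\le j\le r-2$, $\bar K_j=\begin{pmatrix} I_q\otimes F_j+S_q\otimes F_j' & -(\ell_q\varphi^\top)\otimes \frac{1}{j!}G_{j0}^{(j)}\\ 0 & I_{\nu'-q}\otimes I_r-S_{\nu'-q}\otimes G\end{pmatrix}$; $\bar K_{r-1}=\begin{pmatrix}0_{q\times(\nu'-q)r}\\ I_{\nu'-q}\otimes I_r-S_{\nu'-q}\otimes G\end{pmatrix}$; $\bar K_j=I_{\nu'-q}\otimes I_r-S_{\nu'-q}\otimes G$ for $j\ge r$; and $\bar{\mathcal{K}}^{\mu-1}=\bar K_0\bar K_1\cdots\bar K_{\mu-1}$. *)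

(* Defs.v *)
From HB Require Import structures.
From mathcomp Require Import all_boot all_order all_algebra.
From mathcomp Require Import reals.
From mathcomp Require Export complex mxtens.

Set Implicit Arguments.
Unset Strict Implicit.
Unset Printing Implicit Defensive.

Import Order.TTheory GRing.Theory Num.Theory.
Local Open Scope ring_scope.

Section Defs.
Variable C : fieldType.

Definition pder (n : nat) {m p : nat} (A : 'M[{poly C}]_(m, p)) : 'M[{poly C}]_(m, p) :=
  map_mx (fun P => P^`(n)) A.

Definition pev (z : C) {m p : nat} (A : 'M[{poly C}]_(m, p)) : 'M[C]_(m, p) :=
  map_mx (fun P => P.[z]) A.

Definition uvec (q : nat) : 'cV[{poly C}]_q := \col_(a < q) 'X^a.
Definition wvec (r : nat) : 'rV[{poly C}]_r := \row_(b < r) 'X^b.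
Definition Mpoly (q r : nat) : 'M[{poly C}]_(q, r) := uvec q *m wvec r.

(* N(z) : block (i,j) (i < mu, j < nu) is (1/(i! j!)) M^(i+j)(z);
   delta_mx i j *t B places B in block position (i,j) (Kronecker product). *)
Definition Nmx (q r mu nu : nat) (z : C) : 'M[C]_(mu * q, nu * r) :=
  \sum_(i < mu) \sum_(j < nu)
     (delta_mx i j *t
       ((i`!%:R * j`!%:R)^-1 *: pev z (pder (i + j) (Mpoly q r)))).

Definition shiftmx (n : nat) : 'M[C]_n := \matrix_(i < n, j < n) (i.+1 == j :> nat)%:R.

Definition lastvec (q : nat) : 'cV[C]_q := \col_(a < q) (a == q.-1 :> nat)%:R.
Definition firstvec (s : nat) : 'cV[C]_s := \col_(b < s) (b == 0 :> nat)%:R.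

Definition Gpoly (r : nat) : 'M[{poly C}]_r :=
  \matrix_(i < r, j < r) (if (i < j)%N then 'X^(j - i - 1) else 0).

Definition Gj0 (r j : nat) : 'M[{poly C}]_(r - j, r) :=
  \matrix_(i < r - j, k < r) Gpoly r (widen_ord (leq_subr j r) i) k.

Definition Fpoly (r j : nat) : 'M[{poly C}]_(r - j, r - j - 1) :=
  \matrix_(a < r - j, b < r - j - 1)
     (if a == b :> nat then - 'X else if a == b.+1 :> nat then 1 else 0).

Definition Kbot (q r nup : nat) (z : C) : 'M[C]_((nup - q) * r) :=
  (1%:M : 'M[C]_(nup - q)) *t (1%:M : 'M[C]_r)
  - shiftmx (nup - q) *t pev z (Gpoly r).

Definition Kdim (q r nup j : nat) : nat :=
  if (j < r)%N then (q * (r - j) + (nup - q) * r)%N else ((nup - q) * r)%N.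

(* \bar K_j : 'M_(Kdim j, Kdim (j+1)).  The case split is
   0 <= j <= r-2  (i.e. j+1 < r),  j = r-1,  j >= r.
   conform_mx only fixes the (provably equal) dimension indices. *)
Definition Kj (q r nup : nat) (z : C) (j : nat) : 'M[C]_(Kdim q r nup j, Kdim q r nup j.+1) :=
  if (j.+1 < r)%N then
    conform_mx 0
      (block_mx
         ((1%:M : 'M[C]_q) *t pev z (Fpoly r j)
            + shiftmx q *t pev z (pder 1 (Fpoly r j)))
         (- ((lastvec q *m (firstvec (nup - q))^T)
               *t ((j`!%:R)^-1 *: pev z (pder j (Gj0 r j)))))
         0
         (Kbot q r nup z))
  else if j.+1 == r then
    conform_mx 0 (col_mx (0 : 'M[C]_(q, (nup - q) * r)) (Kbot q r nup z))
  else conform_mx 0 (Kbot q r nup z).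

Fixpoint Kprod (q r nup : nat) (z : C) (n : nat) :
    'M[C]_(Kdim q r nup 0, Kdim q r nup n) :=
  match n return 'M[C]_(Kdim q r nup 0, Kdim q r nup n) with
  | 0 => 1%:M
  | n'.+1 => Kprod q r nup z n' *m Kj q r nup z n'
  end.

Definition Kbar (q r nup mu : nat) (z : C) := Kprod q r nup z mu.

Definition Kbarbar (q r mu nu : nat) (z : C) :
    'M[C]_(nu * r, Kdim q r (q + r - 1) mu + r * (nu - q - r + 1)) :=
  conform_mx 0
    (block_mx (Kbar q r (q + r - 1) mu z) 0
              0 (1%:M : 'M[C]_(r * (nu - q - r + 1)))).

End Defs.

(* Main.v *)
(* With Q_n := M^(n)(z) / n!, block (i, j) of N(z) is C(i+j, i) Q_(i+j). Denote by
   N_(k,i) the product of the i-th block row of N(z) with K_0 ... K_(k-1), for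
   k <= i. The identities Q_n F = Q_(n-1), Q_n F' = - Q_n (with one column fewer on
   the right-hand sides) and Q_n G^(k) / k! = Q_(n+k+1) for n >= q - 1, together
   with Pascal's rule, show that N_(k,i) consists of q blocks
   C(i-k+j, j) Q_(i-k+j) of width r - k followed by blocks
   C(i-k+q+b, i-k) Q_(i+q+b) of width r, and that N_(k,k) K_k = 0. For k < r the
   matrix N_(k,k) has full row rank q; all K_k have full column rank; so by counting
   dimensions the columns of K_k span ker N_(k,k). For k >= r, N_(k,k) = 0 and K_k is
   invertible. By induction the columns of K_0 ... K_(n-1) span the common kernel of
   the first n block rows. Blocks with j >= q + r - 1 vanish because deg M = q + r - 2. *)

Require Import Defs.
From HB Require Import structures.
From mathcomp Require Import all_boot all_order all_algebra.
From mathcomp Require Import reals complex mxtens.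
From mathcomp Require Import zify.

Set Implicit Arguments.
Unset Strict Implicit.
Unset Printing Implicit Defensive.

Import Order.TTheory GRing.Theory Num.Theory.
Local Open Scope ring_scope.

(** Both sides count the (n+k+1)-subsets of {0, ..., N}, the left one by the position x of the
    element with n elements below it and k above it. The proof is a double induction with Pascal's
    rule. *)
Lemma bin_convolution N n k :
  (\sum_(x < N.+1) 'C(x, n) * 'C(N - x, k) = 'C(N.+1, (n + k).+1))%N.
Proof.
elim: k N => [|k IHk] N.
  under eq_bigr => x _ do rewrite bin0 muln1.
  rewrite addn0; elim: N => [|N IHN]; first by rewrite big_ord1 binS bin0n; case: n.
  by rewrite big_ord_recr /= IHN [RHS]binS.
elim: N => [|N IHN].
  by rewrite big_ord1 /= bin0n muln0 bin_small // addnS.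
rewrite big_ord_recr /= subnn bin0n muln0 addn0.
transitivity (\sum_(x < N.+1) ('C(x, n) * 'C(N - x, k.+1) + 'C(x, n) * 'C(N - x, k)))%N.
  by apply: eq_bigr => x _; rewrite subSn ?binS ?mulnDr // -ltnS.
by rewrite big_split /= IHN IHk addnS [RHS]binS.
Qed.

(** * Linear algebra: dimension casts, full column rank, kernels by dimension count *)

Section Conform.
Variable K : fieldType.

Lemma mul_conform_mx (m n p m' n' p' : nat) (A : 'M[K]_(m, n)) (B : 'M[K]_(n, p)) :
  m = m' -> n = n' -> p = p' ->
  (conform_mx 0 A : 'M_(m', n')) *m (conform_mx 0 B : 'M_(n', p'))
    = conform_mx 0 (A *m B).
Proof. by move=> em en ep; subst; rewrite !conform_mx_id. Qed.

Lemma conform_mx0 (m n m' n' : nat) :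
  conform_mx (0 : 'M[K]_(m', n')) (0 : 'M[K]_(m, n)) = 0.
Proof.
have [[em en]|h] := (@andP (m == m') (n == n')).
  by case: _ / (eqP em); case: _ / (eqP en); rewrite conform_mx_id.
by rewrite nonconform_mx // -negb_and; apply/negP => /andP.
Qed.

Lemma mul_conform_row_col0 (m n1 n1' n2 n p p' : nat)
    (A : 'M[K]_(m, n1)) (D : 'M[K]_(n2, p)) :
  n1 = n1' -> (n1 + n2 = n)%N -> p = p' ->
  (conform_mx 0 (row_mx A (0 : 'M[K]_(m, n2))) : 'M_(m, n))
    *m (conform_mx 0 (col_mx (0 : 'M[K]_(n1', p)) D) : 'M_(n, p')) = 0.
Proof. by move=> *; subst; rewrite !conform_mx_id mul_row_col mulmx0 mul0mx addr0. Qed.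

(** Full column rank as left cancellation, a form that passes through products and block matrices
    without rank arithmetic; [col_free_trmx] leads back to ranks. *)
Definition col_free (m n : nat) (A : 'M[K]_(m, n)) :=
  forall p (Y : 'M[K]_(n, p)), A *m Y = 0 -> Y = 0.

Lemma col_free_conform (m n m' n' : nat) (A : 'M[K]_(m, n)) :
  m = m' -> n = n' -> col_free A -> col_free (conform_mx (0 : 'M[K]_(m', n')) A).
Proof. by move=> *; subst; rewrite conform_mx_id. Qed.

Lemma col_free_trmx (m n : nat) (A : 'M[K]_(m, n)) : col_free A -> row_free A^T.
Proof.
move=> fA; apply: inj_row_free => v vA; apply: trmx_inj; rewrite trmx0.
by apply: fA; apply: trmx_inj; rewrite trmx_mul trmxK vA trmx0.
Qed.

Lemma row_free_conform (m n n' : nat) (A : 'M[K]_(m, n)) :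
  n = n' -> row_free A -> row_free (conform_mx (0 : 'M[K]_(m, n')) A).
Proof. by move=> *; subst; rewrite conform_mx_id. Qed.

Lemma row_free_row_mx (m n1 n2 : nat) (A : 'M[K]_(m, n1)) (B : 'M[K]_(m, n2)) :
  row_free A -> row_free (row_mx A B).
Proof.
move=> fA; apply: inj_row_free => v; rewrite mul_mx_row -row_mx0 => /eq_row_mx[+ _].
by move/eqP; rewrite mulmx_free_eq0 // => /eqP.
Qed.

Lemma conform_unitmx_surj (m n m' p : nat) (D : 'M[K]_m) (X : 'M[K]_(m', p)) :
  m = m' -> m = n -> D \in unitmx ->
  exists Y, X = (conform_mx 0 D : 'M_(m', n)) *m Y.
Proof.
by move=> *; subst; exists (invmx D *m X); rewrite conform_mx_id mulKVmx.
Qed.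

Lemma col_free_col_mx (m1 m2 n : nat) (A : 'M[K]_(m1, n)) (B : 'M[K]_(m2, n)) :
  col_free B -> col_free (col_mx A B).
Proof. by move=> fB p Y; rewrite mul_col_mx -(col_mx0 _ m1 m2) => /eq_col_mx[_ /fB]. Qed.

Lemma unitmx_col_free n (A : 'M[K]_n) : A \in unitmx -> col_free A.
Proof. by move=> uA p Y AY; rewrite -(mulKmx uA Y) AY mulmx0. Qed.

Lemma col_free_mul m n p (A : 'M[K]_(m, n)) (B : 'M[K]_(n, p)) :
  col_free A -> col_free B -> col_free (A *m B).
Proof. by move=> fA fB k Y; rewrite -mulmxA => /fA/fB. Qed.

Lemma col_free_block m1 m2 n1 n2 (T : 'M[K]_(m1, n1)) (B : 'M[K]_(m1, n2)) (D : 'M[K]_(m2, n2)) :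
  col_free T -> col_free D -> col_free (block_mx T B 0 D).
Proof.
move=> fT fD p Y; rewrite -(vsubmxK Y) mul_block_col mul0mx add0r -(col_mx0 _ m1 m2).
by move=> /eq_col_mx[+ /fD eY]; rewrite eY mulmx0 addr0 => /fT ->; rewrite col_mx0.
Qed.

(** The column space of [B] lies in ker [A], and both have dimension p = n - m. The argument runs on
    transposes because [kermx] is a row kernel. *)
Lemma exact_sequence m n p (A : 'M[K]_(m, n)) (B : 'M[K]_(n, p)) :
  (m + p = n)%N -> row_free A -> col_free B -> A *m B = 0 ->
  forall k (X : 'M[K]_(n, k)), A *m X = 0 -> exists Y, X = B *m Y.
Proof.
move=> dims fA /col_free_trmx fB AB0 k X AX0.
have sB : (B^T <= kermx A^T)%MS by apply/sub_kermxP; rewrite -trmx_mul AB0 trmx0.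
have sX : (X^T <= kermx A^T)%MS by apply/sub_kermxP; rewrite -trmx_mul AX0 trmx0.
have eB : (B^T == kermx A^T)%MS.
  rewrite -(geq_leqif (mxrank_leqif_eq sB)) mxrank_ker mxrank_tr (eqP fA) (eqP fB).
  by rewrite -dims addKn.
move: sX; rewrite -(eqmxP eB) => /submxP[Y eX].
by exists Y^T; rewrite -[X]trmxK eX trmx_mul trmxK.
Qed.

Lemma conform_mx_trans (m n n' n'' : nat) (A : 'M[K]_(m, n)) :
  n = n' -> n' = n'' ->
  conform_mx (0 : 'M_(m, n'')) (conform_mx (0 : 'M_(m, n')) A) = conform_mx 0 A.
Proof. by move=> *; subst; rewrite !conform_mx_id. Qed.

Lemma conform_row_mx0 (m n1 n2 n1' n2' n' : nat) (A : 'M[K]_(m, n1)) :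
  n1 = n1' -> n2 = n2' -> (n1 + n2 = n')%N ->
  conform_mx (0 : 'M_(m, n')) (row_mx A (0 : 'M_(m, n2))) =
  conform_mx 0 (row_mx (conform_mx 0 A : 'M_(m, n1')) (0 : 'M_(m, n2'))).
Proof. by move=> *; subst; rewrite !conform_mx_id. Qed.

(** Every [A' i] ignores the last [n2] coordinates, so these are free in the common kernel and
    account for the identity block of [B']. *)
Lemma exact_sequence_pad (I : Type) (P : I -> Prop) (m n1 n2 n' p1 : nat)
    (A : I -> 'M[K]_(m, n1)) (B : 'M[K]_(n1, p1))
    (A' := fun i => conform_mx 0 (row_mx (A i) (0 : 'M_(m, n2))) : 'M_(m, n'))
    (B' := conform_mx 0 (block_mx B 0 0 (1%:M : 'M_n2)) : 'M_(n', p1 + n2)) :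
  (n1 + n2 = n')%N -> (forall i, P i -> A i *m B = 0) -> col_free B ->
  (forall p (X : 'M_(n1, p)), (forall i, P i -> A i *m X = 0) -> exists Y, X = B *m Y) ->
  [/\ forall i, P i -> A' i *m B' = 0, col_free B' &
    forall p (X : 'M_(n', p)), (forall i, P i -> A' i *m X = 0) -> exists Y, X = B' *m Y].
Proof.
rewrite {}/A' {}/B' => e AB fB exB; subst n'; rewrite conform_mx_id; split.
- by move=> i Pi; rewrite conform_mx_id mul_row_block !mulmx0 mul0mx !addr0 AB // row_mx0.
- by apply: col_free_block => // p Y; rewrite mul1mx.
move=> p X AX; have [i Pi|Y eY] := exB p (usubmx X).
  by rewrite -[RHS](AX i Pi) conform_mx_id -[in RHS](vsubmxK X) mul_row_col mul0mx addr0.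
exists (col_mx Y (dsubmx X)).
by rewrite mul_block_col !mul0mx addr0 add0r mul1mx -eY vsubmxK.
Qed.
End Conform.

(** * Rows of blocks multiplied by Kronecker products *)

Section HBlocks.
Variable C : numFieldType.
Variable z : C.

(* The row of n blocks of size m x p whose j-th block has entries f j a b. Indexing
   by nat lets the formula for f be shared between matrices of different widths. *)
Definition hblocks m n p (f : nat -> nat -> nat -> C) : 'M[C]_(m, n * p) :=
  \matrix_(a, c) f (c %/ p)%N a (c %% p)%N.

Lemma eq_hblocks m n p f g :
  (forall j a b, (j < n)%N -> (a < m)%N -> (b < p)%N -> f j a b = g j a b) ->
  hblocks m n p f = hblocks m n p g.
Proof.
move=> efg; apply/matrixP => a c; rewrite !mxE efg //.
- exact: mxtens_index_proof1.
- exact: mxtens_index_proof2.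
Qed.

Lemma hblocks_add m n1 n2 n' p f :
  (n1 + n2 = n')%N ->
  hblocks m n' p f =
  conform_mx 0 (row_mx (hblocks m n1 p f) (hblocks m n2 p (fun j => f (n1 + j)%N))).
Proof.
move=> <-; have e := esym (mulnDl n1 n2 p).
rewrite -(conform_castmx (erefl m, e)) conform_mx_id.
apply/matrixP => a c; rewrite castmxE !mxE; case: splitP => /= k ->; rewrite !mxE cast_ord_id //.
have p_gt0 : (0 < p)%N by case: (p) k => // -[k]; rewrite muln0.
by rewrite divnMDl // modnMDl.
Qed.

Lemma mul_hblocks_tens m n p n' p' f (X : 'M[C]_(n, n')) (Y : 'M[C]_(p, p')) a c :
  (hblocks m n p f *m (X *t Y)) a c =
  \sum_(j < n) X j (mxtens_unindex c).1 * \sum_(b < p) f j a b * Y b (mxtens_unindex c).2.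
Proof.
rewrite mxE (reindex (@mxtens_index n p)) /=; last first.
  by exists (@mxtens_unindex n p) => ? _; rewrite ?mxtens_indexK ?mxtens_unindexK.
under [RHS]eq_bigr => j _ do rewrite mulr_sumr.
rewrite pair_big /=; apply: eq_bigr => -[j b] _ /=.
have := mxtens_indexK (j, b) => /(congr1 (fun u => (val u.1, val u.2))) /= [ej eb].
by rewrite !mxE mxtens_indexK /= ej eb mulrCA.
Qed.

Lemma mul_hblocks_tens1 m n p p' f (Y : 'M[C]_(p, p')) a c :
  (hblocks m n p f *m (1%:M *t Y)) a c =
  \sum_(b < p) f (c %/ p')%N a b * Y b (mxtens_unindex c).2.
Proof.
rewrite mul_hblocks_tens (bigD1 (mxtens_unindex c).1) //= mxE eqxx mul1r [X in _ + X]big1 ?addr0 //.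
by move=> j /negPf ne; rewrite mxE ne mul0r.
Qed.

Lemma mul_hblocks_tens_shift m n p p' f (Y : 'M[C]_(p, p')) a c :
  (hblocks m n p f *m (shiftmx C n *t Y)) a c =
  if (c %/ p')%N is j.+1 then \sum_(b < p) f j a b * Y b (mxtens_unindex c).2 else 0.
Proof.
rewrite mul_hblocks_tens.
(* The block index is generalized as an ordinal with value [c %/ p'], so that the case analysis also
   supplies the bound needed to name the preceding block. *)
move: (mxtens_unindex c).2 (mxtens_unindex c).1 (erefl : val (mxtens_unindex c).1 = c %/ p')%N.
move=> b' d <-; case: d => -[|d] lt /=; first by rewrite big1 // => j _; rewrite mxE mul0r.
rewrite (bigD1 (Ordinal (ltnW lt))) //= mxE /= eqxx mul1r [X in _ + X]big1 ?addr0 //.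
by move=> j; rewrite -val_eqE mxE /= eqSS => /negPf ->; rewrite mul0r.
Qed.

(** The left Kronecker factor has a single nonzero entry, a one in its last row and column 0. *)
Lemma mul_hblocks_tens_corner m n s p p' f (Y : 'M[C]_(p, p')) a c : (0 < n)%N ->
  (hblocks m n p f *m ((lastvec C n *m (firstvec C s)^T) *t Y)) a c =
  if (c %/ p')%N is 0%N then \sum_(b < p) f n.-1 a b * Y b (mxtens_unindex c).2 else 0.
Proof.
move=> n_gt0; rewrite mul_hblocks_tens.
have ltn : (n.-1 < n)%N by rewrite prednK.
move: (mxtens_unindex c).2 (mxtens_unindex c).1 (erefl : val (mxtens_unindex c).1 = c %/ p')%N.
move=> b' d <-; case: d => -[|d] lt /=.
  rewrite (bigD1 (Ordinal ltn)) //= mxE big_ord1 !mxE /= eqxx !mul1r [X in _ + X]big1 ?addr0 //.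
  by move=> j; rewrite -val_eqE mxE big_ord1 !mxE /= => /negPf ->; rewrite !mul0r.
by rewrite big1 // => j _; rewrite mxE big_ord1 !mxE mulr0 mul0r.
Qed.

Lemma tens1mx1 n p : (1%:M : 'M[C]_n) *t (1%:M : 'M[C]_p) = 1%:M.
Proof.
apply/matrixP => i j; case: (mxtens_indexP i) => a b; case: (mxtens_indexP j) => c d.
rewrite tensmxE !mxE (can_eq (@mxtens_indexK n p)) xpair_eqE.
by case: (a == c); rewrite ?mul1r ?mul0r.
Qed.

(** The transpose is lower triangular with ones on the diagonal, whatever [X] is. *)
Lemma unitmx_sub_shift n p (X : 'M[C]_p) :
  (1%:M : 'M[C]_n) *t (1%:M : 'M[C]_p) - shiftmx C n *t X \in unitmx.
Proof.
rewrite tens1mx1 -unitmx_tr unitmxE det_trig.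
  rewrite big1 ?unitr1 // => c _; rewrite !mxE /= eqxx.
  by rewrite eqn_leq ltnn mul0r subr0.
apply/is_trig_mxP => c d lt; rewrite !mxE -val_eqE gtn_eqF //= sub0r.
case: eqP => [e|_]; last by rewrite mul0r oppr0.
by have := leq_div2r p (ltnW lt); rewrite -e ltnn.
Qed.

End HBlocks.

(** * Taylor coefficients of M(z) and their products with F and G *)

Section Factors.
Variable C : numFieldType.
Variable z : C.

(* Entry (a, b) of Q_n = M^(n)(z) / n!; when a + b < n the exponent is truncated but
   the binomial vanishes. *)
Definition taylor (n a b : nat) : C := z ^+ (a + b - n) *+ 'C(a + b, n).

Lemma taylorS n a b : taylor n.+1 a b.+1 - z * taylor n.+1 a b = taylor n a b.
Proof.
rewrite /taylor addnS subSS binS mulrnDr mulrnAr -exprS.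
have [lt|le] := ltnP n (a + b); first by rewrite subnSK // addrC addKr.
by rewrite (bin_small (m := n.+1)) ?ltnS // !mulr0n subr0 add0r.
Qed.

Lemma taylor0S a b : taylor 0 a b.+1 - z * taylor 0 a b = 0.
Proof. by rewrite /taylor !subn0 !bin0 !mulr1n addnS -exprS subrr. Qed.

Lemma taylor_small n a b : (a + b < n)%N -> taylor n a b = 0.
Proof. by move=> lt; rewrite /taylor bin_small. Qed.

(** Every nonzero term carries the power z^(a+c-(n+k+1)), so only a convolution of binomials
    remains. The case k = 0 serves G itself, general k serves the truncated G^(k)/k!. *)
Lemma taylor_G n k p a c : (a <= n)%N -> (c <= p + k)%N ->
  \sum_(b < p) taylor n a b *
     (if (b < c)%N then z ^+ (c - b - 1 - k) *+ 'C(c - b - 1, k) else 0)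
  = taylor (n + k).+1 a c.
Proof.
move=> le_an le_c.
transitivity (\sum_(b < p | (b < c)%N)
    z ^+ (a + c - (n + k).+1) *+ ('C(a + b, n) * 'C(c - b - 1, k))).
  rewrite [RHS]big_mkcond /=; apply: eq_bigr => b _; case: ifP => lt; last by rewrite mulr0.
  rewrite /taylor mulrnAl mulrnAr -mulrnA mulnC -exprD.
  have [l1|l1] := ltnP (a + b) n; first by rewrite (bin_small l1) !(mul0n, muln0).
  have [l2|l2] := ltnP (c - b - 1) k; first by rewrite (bin_small l2) !(mul0n, muln0).
  by congr (_ ^+ _ *+ _); lia.
rewrite /taylor sumrMnr; congr (_ *+ _).
transitivity (\sum_(b < c) 'C(a + b, n) * 'C(c - b - 1, k))%N.
  (* Both index ranges are embedded in b < p + c; the terms with p <= b < c vanish because c - b - 1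
     < k. *)
  rewrite (big_ord_widen_cond (p + c) (fun b => b < c)%N
    (fun b => 'C(a + b, n) * 'C(c - b - 1, k))%N) ?leq_addr //.
  rewrite [RHS](big_ord_widen (p + c) (fun b => 'C(a + b, n) * 'C(c - b - 1, k))%N) ?leq_addl //.
  rewrite big_mkcond [RHS]big_mkcond /=; apply: eq_bigr => b _.
  case: (ltnP b c) => //= lt; case: ltnP => // le.
  by rewrite (bin_small (n := c - b - 1)) ?muln0 //; lia.
case: c le_c => [|c] _.
  by rewrite big_ord0 bin_small // addn0; lia.
(* With x = a + b this is the full convolution: its terms with x < a vanish since a <= n. *)
rewrite addnS -bin_convolution -addnS big_split_ord /= [X in (X + _)%N]big1 ?add0n.
  by apply: eq_bigr => b _; congr (_ * 'C(_, _))%N; lia.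
by move=> b _; rewrite bin_small //; have := ltn_ord b; lia.
Qed.

Lemma pev_Fpoly r j (a : 'I_(r - j)) (b : 'I_(r - j - 1)) :
  pev z (Fpoly C r j) a b = (a == b.+1 :> nat)%:R - z * (a == b :> nat)%:R.
Proof.
rewrite !mxE; case: eqP => [->|_].
  by rewrite hornerN hornerX eqn_leq ltnn andbF sub0r mulr1.
by case: eqP => _; rewrite ?hornerC ?horner0 mulr0 subr0.
Qed.

Lemma pev_pder1_Fpoly r j (a : 'I_(r - j)) (b : 'I_(r - j - 1)) :
  pev z (pder 1 (Fpoly C r j)) a b = - (a == b :> nat)%:R.
Proof.
rewrite !mxE derivn1; case: eqP => _.
  by rewrite derivN derivX hornerN hornerC.
by case: eqP => _; rewrite ?derivC ?deriv0 ?horner0 oppr0.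
Qed.

Lemma pev_Gj0 r j (a : 'I_(r - j)) (c : 'I_r) :
  ((j`!%:R)^-1 *: pev z (pder j (Gj0 C r j))) a c =
  if (a < c)%N then z ^+ (c - a - 1 - j) *+ 'C(c - a - 1, j) else 0.
Proof.
rewrite !mxE /=; case: ifP => _; last by rewrite derivnC; case: eqP; rewrite horner0 mulr0.
rewrite derivnXn hornerMn hornerXn -bin_ffact mulrnA -[X in _ * X]mulr_natl mulKf //.
by rewrite pnatr_eq0 -lt0n fact_gt0.
Qed.

Lemma pev_Gpoly r (a c : 'I_r) :
  pev z (Gpoly C r) a c = if (a < c)%N then z ^+ (c - a - 1) else 0.
Proof. by rewrite !mxE; case: ifP => _; rewrite ?hornerXn ?horner0. Qed.

Lemma sum_delta p (h : nat -> C) b : (b < p)%N ->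
  \sum_(a < p) h a * (a == b :> nat)%:R = h b.
Proof.
move=> lt; rewrite (bigD1 (Ordinal lt)) //= eqxx mulr1 big1 ?addr0 //.
by move=> a; rewrite -val_eqE => /negPf /= ->; rewrite mulr0.
Qed.

Lemma sum_Fpoly r j (h : nat -> C) (b : 'I_(r - j - 1)) :
  \sum_(a < r - j) h a * pev z (Fpoly C r j) a b = h b.+1 - z * h b.
Proof.
have lt := ltn_ord b.
under eq_bigr => a _ do rewrite pev_Fpoly mulrBr mulrCA.
by rewrite sumrB -mulr_sumr !sum_delta //; lia.
Qed.

Lemma sum_pder1_Fpoly r j (h : nat -> C) (b : 'I_(r - j - 1)) :
  \sum_(a < r - j) h a * pev z (pder 1 (Fpoly C r j)) a b = - h b.
Proof.
have lt := ltn_ord b.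
under eq_bigr => a _ do rewrite pev_pder1_Fpoly mulrN.
by rewrite sumrN sum_delta //; lia.
Qed.

(** * Products of the reduced block rows with the blocks of K_j *)

Definition Ktop q r j : 'M[C]_(q * (r - j), q * (r - j - 1)) :=
  (1%:M : 'M[C]_q) *t pev z (Fpoly C r j) + shiftmx C q *t pev z (pder 1 (Fpoly C r j)).

Definition Kcorner q r s j : 'M[C]_(q * (r - j), s * r) :=
  (lastvec C q *m (firstvec C s)^T) *t ((j`!%:R)^-1 *: pev z (pder j (Gj0 C r j))).

(* The left and right parts of N_(k,i), with n = i - k and p = r - k. *)
Definition Ptop q p n : 'M[C]_(q, q * p) :=
  hblocks q q p (fun j a b => taylor (n + j) a b *+ 'C(n + j, n)).

Definition Pbot q r s i n : 'M[C]_(q, s * r) :=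
  hblocks q s r (fun b a c => taylor (i + q + b) a c *+ 'C(n + q + b, n)).

(** In column block d > 0, F yields Q_(n+d) with coefficient C(n+1+d, n+1) and the shifted F'
    subtracts C(n+d, n+1) times the same Q_(n+d); Pascal leaves C(n+d, n). *)
Lemma mul_Ptop_Ktop q r j n : Ptop q (r - j) n.+1 *m Ktop q r j = Ptop q (r - j - 1) n.
Proof.
apply/matrixP => a c; rewrite mulmxDr mxE mul_hblocks_tens1 mul_hblocks_tens_shift.
rewrite (sum_Fpoly (fun b => taylor _ a b *+ _)) mxE /=.
rewrite mulrnAr -mulrnBl addSn taylorS.
case: (c %/ _)%N => [|d]; first by rewrite addr0 addn0 !binn.
by rewrite (sum_pder1_Fpoly (fun b => taylor _ a b *+ _)) /= addSnnS binS mulrnDr addrAC subrr add0r.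
Qed.

Lemma mul_Ptop_Ktop0 q r j : Ptop q (r - j) 0 *m Ktop q r j = 0.
Proof.
apply/matrixP => a c; rewrite mulmxDr mxE mul_hblocks_tens1 mul_hblocks_tens_shift.
rewrite (sum_Fpoly (fun b => taylor _ a b *+ _)) mxE /= !bin0 !mulr1n add0n.
case: (c %/ _)%N => [|d]; first by rewrite addr0 taylor0S.
by rewrite (sum_pder1_Fpoly (fun b => taylor _ a b *+ _)) /= taylorS add0n bin0 subrr.
Qed.

Lemma sum_taylor_G r n a (c : 'I_r) m : (a <= n)%N ->
  \sum_(b < r) taylor n a b *+ m * pev z (Gpoly C r) b c = taylor n.+1 a c *+ m.
Proof.
move=> le; have lt := ltn_ord c.
rewrite -[in RHS](addn0 n) -(taylor_G le (p := r)) ?addn0 ?(ltnW lt) // -sumrMnl.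
apply: eq_bigr => b _; rewrite pev_Gpoly mulrnAl.
by case: ifP; rewrite // subn0 bin0.
Qed.

Lemma sum_taylor_Gj0 r j n a (c : 'I_r) m : (a <= n)%N ->
  \sum_(b < r - j) taylor n a b *+ m * ((j`!%:R)^-1 *: pev z (pder j (Gj0 C r j))) b c
  = taylor (n + j).+1 a c *+ m.
Proof.
move=> le; have lt := ltn_ord c.
rewrite -(taylor_G le (p := r - j)); last by lia.
by rewrite -sumrMnl; apply: eq_bigr => b _; rewrite pev_Gj0 mulrnAl.
Qed.

(** In column block b > 0 the shift in [Kbot] subtracts the contribution of block b - 1. In block 0
    the corner does this with the last block of [Ptop], so Pascal's rule applies uniformly. *)
Lemma mul_P_last q r nup j n : (0 < q)%N ->
  Ptop q (r - j) n *m (- Kcorner q r (nup - q) j)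
    + Pbot q r (nup - q) (n + j) n *m Kbot q r nup z
  = if n is n'.+1 then Pbot q r (nup - q) (n + j) n' else 0.
Proof.
move=> q_gt0; set s := (nup - q)%N.
transitivity (hblocks q s r (fun b a c => taylor (n + j + q + b) a c *+
       (if n is n'.+1 then 'C(n' + q + b, n') else 0))); last first.
  by case: n => // ; apply/matrixP => a c; rewrite !mxE mulr0n.
apply/matrixP => a c; rewrite mulmxN /Kbot mulmxBr tens1mx1 mulmx1 mxE [X in X + _]mxE [X in _ + X]mxE.
rewrite [X in _ + (X + _)]mxE [X in _ + (_ + X)]mxE [RHS]mxE.
have lt := ltn_ord a.
have -> : (Ptop q (r - j) n *m Kcorner q r s j) a c =
  if (c %/ r)%N is 0%N then taylor (n + j + q) a (c %% r)%N *+ 'C(n + q.-1, n) else 0.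
  rewrite mul_hblocks_tens_corner //; case: (c %/ r)%N => // .
  rewrite sum_taylor_Gj0 /=; last by lia.
  by congr (taylor _ _ _ *+ _); lia.
have -> : (Pbot q r s (n + j) n *m (shiftmx C s *t pev z (Gpoly C r))) a c =
  if (c %/ r)%N is b.+1 then taylor (n + j + q + b.+1) a (c %% r)%N *+ 'C(n + q + b, n) else 0.
  rewrite mul_hblocks_tens_shift; case: (c %/ r)%N => // b.
  rewrite sum_taylor_G /=; last by lia.
  by rewrite addnS.
(* At n = 0 both binomials equal 1 and the remainder is 0, which gives the vanishing case. *)
have pascal m : (0 < m)%N ->
    'C(n + m, n) = ('C(n + m.-1, n) + (if n is n'.+1 then 'C(n' + m, n') else 0))%N.
  case: m => // m _; case: (n) => [|n']; first by rewrite !bin0.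
  by rewrite addSn binS addnS addSn.
case: (c %/ r)%N => [|b].
  by rewrite !addn0 subr0 (pascal q) // mulrnDr addKr; case: (n) => [|?]; rewrite ?addn0.
rewrite oppr0 add0r -(addnA n q) (pascal (q + b.+1)%N) ?addnS // mulrnDr addnA.
by rewrite addrAC subrr add0r; case: (n) => // n'; rewrite !addnS !addnA.
Qed.

(** The derivatives involved have order at least i + q >= q + r - 1, which exceeds deg M = q + r -
    2. *)
Lemma Pbot_eq0 q r s i n : (r <= i.+1)%N -> Pbot q r s i n = 0.
Proof.
move=> le; apply/matrixP => a c; rewrite !mxE taylor_small ?mul0rn //.
by move: (c %% r)%N (mxtens_index_proof2 c) (c %/ r)%N (ltn_ord a) => b ltb d lta; lia.
Qed.

(** * Full rank of the blocks *)

Lemma col_free_Ktop q r j : (j.+1 < r)%N -> col_free (Ktop q r j).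
Proof.
move=> lt p Y.
(* L is a left inverse of F_j, so 1 (x) L reduces Ktop to a block unitriangular matrix. *)
pose L : 'M[C]_(r - j - 1, r - j) :=
  \matrix_(b, a) (if (b < a)%N then z ^+ (a - b - 1) else 0).
have LF : L *m pev z (Fpoly C r j) = 1%:M.
  apply/matrixP => b b'.
  have lt' := ltn_ord b'.
  rewrite !mxE; under eq_bigr => a _ do rewrite mxE.
  rewrite (sum_Fpoly (fun a => if (b < a)%N then z ^+ (a - b - 1) else 0)).
  rewrite ltnS -val_eqE /=; case: ltngtP => [l|l|->].
  - by rewrite -exprS -[X in z ^+ X - _](_ : (b' - b - 1).+1 = _) ?subrr //; lia.
  - by rewrite mulr0 subr0.
  - by rewrite subSnn mulr0 subr0.
move=> /(congr1 (fun U => ((1%:M : 'M[C]_q) *t L) *m U)); rewrite mulmx0 mulmxA.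
rewrite mulmxDr !tensmx_mul !mul1mx LF.
have := @unitmx_sub_shift C q _ (- (L *m pev z (pder 1 (Fpoly C r j)))).
rewrite (_ : _ - _ = 1%:M *t 1%:M + shiftmx C q *t (L *m pev z (pder 1 (Fpoly C r j)))).
  by move=> /unitmx_col_free; apply.
by congr (_ + _); apply/matrixP => ? ?; rewrite !mxE mulrN opprK.
Qed.

Lemma row_free_Ptop q p : (0 < p)%N -> row_free (Ptop q p 0).
Proof.
move=> p_gt0.
(* S selects the first column of each block: there Q_j is (C(a, j) z^(a-j))_a,
   which is unitriangular. *)
pose S : 'M[C]_(q * p, q) := \matrix_(c, j) (c == j * p :> nat)%N%:R.
have PS a j : (Ptop q p 0 *m S) a j = taylor j a 0.
  have lt : (j * p < q * p)%N by rewrite ltn_pmul2r.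
  rewrite mxE (bigD1 (Ordinal lt)) //= !mxE /= eqxx mulr1 mulnK // modnMl bin0 add0n.
  rewrite big1 ?addr0 // => c; rewrite -val_eqE => /negPf /= ne.
  by rewrite !mxE ne mulr0.
have : Ptop q p 0 *m S \in unitmx.
  rewrite unitmxE det_trig.
    by rewrite big1 ?unitr1 // => a _; rewrite PS /taylor addn0 subnn binn.
  by apply/is_trig_mxP => a j lt; rewrite PS taylor_small // addn0.
rewrite -row_free_unit -!row_leq_rank => /leq_trans; apply; exact: mxrankM_maxl.
Qed.
End Factors.

(** * Telescoping along the products K_0 ... K_(n-1) *)

Section Kernel.
Variable C : numFieldType.
Variable z : C.
Variables q r : nat.
Hypothesis q_gt0 : (0 < q)%N.

Section Products.
Variable nup : nat.

Lemma Kdim_lt k : (k < r)%N -> Kdim q r nup k = (q * (r - k) + (nup - q) * r)%N.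
Proof. by rewrite /Kdim => ->. Qed.

Lemma Kdim_ge k : (r <= k)%N -> Kdim q r nup k = ((nup - q) * r)%N.
Proof. by rewrite /Kdim ltnNge => ->. Qed.

Lemma Kj_lt k : (k.+1 < r)%N ->
  Kj q r nup z k = conform_mx 0
    (block_mx (Ktop z q r k) (- Kcorner z q r (nup - q) k) 0 (Kbot q r nup z)).
Proof. by rewrite /Kj => ->. Qed.

Lemma Kj_eq k : k.+1 = r ->
  Kj q r nup z k = conform_mx 0 (col_mx (0 : 'M[C]_(q, (nup - q) * r)) (Kbot q r nup z)).
Proof. by rewrite /Kj => ->; rewrite ltnn eqxx. Qed.

Lemma Kj_ge k : (r <= k)%N -> Kj q r nup z k = conform_mx 0 (Kbot q r nup z).
Proof. by rewrite /Kj => le; rewrite gtn_eqF // ltnNge leqW. Qed.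

(* N_(k,i) for k <= i. For k >= r the left part has width 0 and the right part
   vanishes. *)
Definition Nrow k i : 'M[C]_(q, Kdim q r nup k) :=
  if (k < r)%N then
    conform_mx 0 (row_mx (Ptop z q (r - k) (i - k)) (Pbot z q r (nup - q) i (i - k)))
  else 0.

(** Writing the row index as n + k treats the reduction (n > 0) and the annihilation (n = 0)
    together. *)
Lemma mul_Nrow_lt k n : (k.+1 < r)%N ->
  Nrow k (n + k) *m Kj q r nup z k = if n is n'.+1 then Nrow k.+1 (n + k) else 0.
Proof.
move=> lt; rewrite /Nrow lt (ltnW lt) Kj_lt // mul_conform_mx ?Kdim_lt ?(ltnW lt) //; last first.
  by rewrite (subnS r k) subn1.
rewrite mul_row_block mulmx0 addr0 addnK mul_P_last //.
case: n => [|n]; first by rewrite mul_Ptop_Ktop0 row_mx0 conform_mx0.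
by rewrite mul_Ptop_Ktop addSnnS addnK (subnS r k) subn1.
Qed.

Lemma mul_Nrow k i : (k < i)%N -> Nrow k i *m Kj q r nup z k = Nrow k.+1 i.
Proof.
move=> lt; have [lt_r|le_r] := ltnP k.+1 r.
  by rewrite -(subnK (ltnW lt)) mul_Nrow_lt //; case: (i - k)%N (subn_gt0 k i) => //; rewrite lt.
rewrite [RHS]/Nrow ltnNge le_r /= /Nrow; case: ifP => [lt_k|_]; last by rewrite mul0mx.
(* At k = r - 1 the zero rows of K_k kill the left part, and the right part is already zero. *)
have e : k.+1 = r by apply/eqP; rewrite eqn_leq lt_k.
rewrite Kj_eq // Pbot_eq0 ?mul_conform_row_col0 ?(Kdim_lt lt_k) ?(Kdim_ge le_r) //; last by rewrite -e ltnW.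
by rewrite -e subSnn muln1.
Qed.

Lemma mul_Nrow_diag k : Nrow k k *m Kj q r nup z k = 0.
Proof.
have [lt_r|le_r] := ltnP k.+1 r; first exact: (mul_Nrow_lt 0 lt_r).
rewrite /Nrow; case: ifP => [lt_k|_]; last by rewrite mul0mx.
have e : k.+1 = r by apply/eqP; rewrite eqn_leq lt_k.
rewrite Kj_eq // Pbot_eq0 ?mul_conform_row_col0 ?(Kdim_lt lt_k) ?(Kdim_ge le_r) //.
by rewrite -e subSnn muln1.
Qed.

Lemma unitmx_Kbot : Kbot q r nup z \in unitmx.
Proof. exact: unitmx_sub_shift. Qed.

Lemma col_free_Kj k : col_free (Kj q r nup z k).
Proof.
have fD := unitmx_col_free unitmx_Kbot.
have [lt|le] := ltnP k.+1 r.
  rewrite Kj_lt //; apply: col_free_conform; rewrite ?Kdim_lt ?(ltnW lt) //.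
    by rewrite (subnS r k) subn1.
  by apply: col_free_block fD; apply: col_free_Ktop.
have [e|lt] := eqVneq k.+1 r.
  rewrite Kj_eq //; apply: col_free_conform; last exact: col_free_col_mx.
    by rewrite Kdim_lt -e // subSnn muln1.
  by rewrite Kdim_ge // e.
have le_k : (r <= k)%N by rewrite -ltnS ltn_neqAle eq_sym lt.
by rewrite Kj_ge //; apply: col_free_conform; rewrite ?Kdim_ge // leqW.
Qed.

Lemma row_free_Nrow k : (k < r)%N -> row_free (Nrow k k).
Proof.
move=> lt; rewrite /Nrow lt subnn; apply: row_free_conform; first by rewrite Kdim_lt.
by apply/row_free_row_mx/row_free_Ptop; rewrite subn_gt0.
Qed.

Lemma Kj_exact k p (X : 'M[C]_(Kdim q r nup k, p)) :
  Nrow k k *m X = 0 -> exists Y, X = Kj q r nup z k *m Y.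
Proof.
have [lt|le] := ltnP k r.
  apply: exact_sequence (row_free_Nrow lt) (@col_free_Kj k) (mul_Nrow_diag k) _ _.
  rewrite (Kdim_lt lt); have [lt'|le'] := ltnP k.+1 r.
    by rewrite Kdim_lt // addnA -mulnS subnSK.
  have e : k.+1 = r by apply/eqP; rewrite eqn_leq lt.
  by rewrite (Kdim_ge le') -e subSnn muln1.
move=> _; rewrite Kj_ge //; apply: conform_unitmx_surj unitmx_Kbot.
  by rewrite Kdim_ge.
by rewrite Kdim_ge // leqW.
Qed.

Lemma mul_Nrow_Kprod n i : (n <= i)%N -> Nrow 0 i *m Kprod q r nup z n = Nrow n i.
Proof.
elim: n => [|n IHn] le; first by rewrite mulmx1.
by rewrite /= mulmxA IHn ?mul_Nrow // ltnW.
Qed.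

Lemma mul_Nrow_Kprod_lt n i : (i < n)%N -> Nrow 0 i *m Kprod q r nup z n = 0.
Proof.
elim: n => // n IHn; rewrite ltnS leq_eqVlt /= mulmxA => /orP[/eqP ->|/IHn ->].
  by rewrite mul_Nrow_Kprod // mul_Nrow_diag.
by rewrite mul0mx.
Qed.

Lemma col_free_Kprod n : col_free (Kprod q r nup z n).
Proof.
elim: n => [|n IHn] /=; last exact: col_free_mul IHn (@col_free_Kj n).
by move=> p Y; rewrite mul1mx.
Qed.

(** If X = K_0 ... K_(n-1) Y, then N_(0,n) X = N_(n,n) Y, so the next condition forces Y to factor
    through K_n. *)
Lemma Kprod_exact n p (X : 'M[C]_(Kdim q r nup 0, p)) :
  (forall i, (i < n)%N -> Nrow 0 i *m X = 0) -> exists Y, X = Kprod q r nup z n *m Y.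
Proof.
elim: n => [|n IHn] NX; first by exists X; rewrite mul1mx.
have [i lt|Y eX] := IHn; first by rewrite NX // ltnW.
have : Nrow n n *m Y = 0 by rewrite -(mul_Nrow_Kprod (leqnn n)) -mulmxA -eX NX.
by move=> /Kj_exact[Y' eY]; exists Y'; rewrite eX eY mulmxA.
Qed.
End Products.

(** * Transfer from nu_* = q + r - 1 to N(z) *)

Hypothesis r_gt0 : (0 < r)%N.
Variables mu nu : nat.
Hypothesis le_nu : (q + r <= nu)%N.

(** The derivative of order i + j contributes (i+j)! C(a+b, i+j), and (i+j)!/(i! j!) = C(i+j, i). *)
Lemma NmxE (i : 'I_mu) (a : 'I_q) (c : 'I_(nu * r)) :
  Nmx q r mu nu z (mxtens_index (i, a)) c =
  taylor z (i + c %/ r) a (c %% r) *+ 'C(i + c %/ r, i).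
Proof.
case: (mxtens_indexP c) => j b.
have := mxtens_indexK (j, b) => /(congr1 (fun u => (val u.1, val u.2))) /= [-> ->].
rewrite summxE (bigD1 i) //= summxE (bigD1 j) //= tensmxE !mxE !eqxx /= mul1r.
rewrite [X in _ + X + _]big1 ?addr0; last first.
  by move=> j' /negPf ne; rewrite tensmxE mxE eq_sym ne andbF mul0r.
rewrite [X in _ + X]big1 ?addr0; last first.
  move=> i' /negPf ne; rewrite summxE big1 // => j' _.
  by rewrite tensmxE mxE eq_sym ne mul0r.
rewrite big_ord1 !mxE -exprD derivnXn hornerMn hornerXn -bin_ffact.
have := bin_fact (leq_addr j i); rewrite addKn => <-.
rewrite mulnA mulrnA -[X in _ * X]mulr_natl natrM mulKf ?mulrnA //.
by rewrite mulf_neq0 // pnatr_eq0 -lt0n fact_gt0.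
Qed.

Definition Nblock i : 'M[C]_(q, nu * r) :=
  hblocks q nu r (fun j a b => taylor z (i + j) a b *+ 'C(i + j, i)).

Lemma mul_Nmx_eq0 p (X : 'M[C]_(nu * r, p)) :
  (Nmx q r mu nu z *m X = 0) <-> (forall i, (i < mu)%N -> Nblock i *m X = 0).
Proof.
have e (i : 'I_mu) a c :
    (Nmx q r mu nu z *m X) (mxtens_index (i, a)) c = (Nblock i *m X) a c.
  by rewrite !mxE; apply: eq_bigr => d _; rewrite NmxE mxE.
split=> [NX i lt|NX].
  by apply/matrixP => a c; rewrite -(e (Ordinal lt)) NX !mxE.
apply/matrixP => d c; case: (mxtens_indexP d) => i a.
by rewrite e NX ?mxE.
Qed.

Lemma Nblock_split i :
  Nblock i = conform_mx 0 (row_mx (Nrow (q + r - 1) 0 i) (0 : 'M_(q, r * (nu - q - r + 1)))).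
Proof.
rewrite /Nblock (hblocks_add q (n1 := q + r - 1) (n2 := nu - (q + r - 1))); last by lia.
rewrite [X in row_mx _ X](_ : _ = 0); last first.
  apply/matrixP => a c; rewrite !mxE taylor_small ?mul0rn //.
  by move: (c %% r)%N (mxtens_index_proof2 c) (c %/ r)%N (ltn_ord a) => b ltb d lta; lia.
have eK : ((q + r - 1) * r = Kdim q r (q + r - 1) 0)%N.
  by rewrite Kdim_lt // subn0 -mulnDl; congr (_ * _)%N; lia.
rewrite (conform_row_mx0 _ eK (n2' := r * (nu - q - r + 1))); first last.
- by rewrite -mulnDl; congr (_ * _)%N; lia.
- by rewrite mulnC; congr (_ * _)%N; lia.
congr (conform_mx 0 (row_mx _ _)).
(* At k = 0 both parts of [Nrow] have block width r and follow one formula, so cutting after q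
   blocks recovers them. *)
rewrite /Nrow r_gt0 (hblocks_add q (n1 := q) (n2 := q + r - 1 - q)); last by lia.
rewrite conform_mx_trans //; last by rewrite -mulnDl; congr (_ * _)%N; lia.
rewrite !subn0; congr (conform_mx 0 (row_mx _ _)).
by apply: eq_hblocks => j a b _ _ _; rewrite !addnA.
Qed.

Lemma kermx_Nmx :
  (kermx (Nmx q r mu nu z)^T == (Kbarbar q r mu nu z)^T)%MS /\
  \rank (kermx (Nmx q r mu nu z)^T) = (nu * r - q * minn mu r)%N.
Proof.
have dims : (Kdim q r (q + r - 1) 0 + r * (nu - q - r + 1) = nu * r)%N.
  rewrite Kdim_lt // subn0 -mulnDl [(r * _)%N]mulnC -mulnDl; congr (_ * _)%N; lia.
have [NK fK exK] := exact_sequence_pad dims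
  (@mul_Nrow_Kprod_lt (q + r - 1) mu) (@col_free_Kprod (q + r - 1) mu)
  (@Kprod_exact (q + r - 1) mu).
have sK : ((Kbarbar q r mu nu z)^T <= kermx (Nmx q r mu nu z)^T)%MS.
  apply/sub_kermxP; rewrite -trmx_mul.
  rewrite (_ : _ *m _ = 0) ?trmx0 //; apply/mul_Nmx_eq0 => i lt.
  by rewrite Nblock_split; apply: NK.
have eK : (kermx (Nmx q r mu nu z)^T == (Kbarbar q r mu nu z)^T)%MS.
  rewrite /eqmx sK andbT -[kermx _]trmxK.
  have [|Y ->] := exK _ (kermx (Nmx q r mu nu z)^T)^T.
    move=> i lt; rewrite -Nblock_split; move: i lt; apply/mul_Nmx_eq0.
    by apply: trmx_inj; rewrite trmx_mul trmxK mulmx_ker trmx0.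
  by rewrite trmx_mul submxMl.
(* Full column rank makes the dimension equal to the number of columns of [Kbarbar]. *)
split=> //; rewrite (eqmxP eK) (eqP (col_free_trmx fK)).
have [lt|le] := ltnP mu r.
  rewrite Kdim_lt // -dims Kdim_lt // subn0 mulnBr.
  by rewrite -!addnA addnBAC // leq_mul2l ltnW ?orbT.
by rewrite Kdim_ge // -dims Kdim_lt // subn0 -addnA addKn.
Qed.
End Kernel.

(* C = R[i] with R : realType, i.e. the complex numbers.
   The (column) kernel of N(z) is the row kernel of N(z)^T; the columns of
   Kbarbar(z) span it iff the rows of Kbarbar(z)^T span the same space. *)
Theorem theorem5p9 (R : realType) (q r mu nu : nat) (z : R[i]) :
  (0 < q)%N -> (0 < r)%N -> (0 < mu)%N -> (q + r <= nu)%N ->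
  (kermx (Nmx q r mu nu z)^T == (Kbarbar q r mu nu z)^T)%MS /\
  \rank (kermx (Nmx q r mu nu z)^T) = (nu * r - q * minn mu r)%N.
Proof. by move=> q_gt0 r_gt0 _ le_nu; exact: (kermx_Nmx z q_gt0 r_gt0 mu le_nu). Qed.
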